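(* The Continuum Hypothesis implies that $\mathrm{sc}(\{f\in\mathbb{R}^{\mathbb{R}} : f \text{ is Borel}\})=\omega_2=(2^{\omega})^{+}$.
   Context: A function $f:\mathbb{R}\to\mathbb{R}$ is Borel if it is Borel measurable; $\kappa^+$ is the successor cardinal of $\kappa$. $\mathbb{R}^{\mathbb{R}}$ is the set of all functions $f:\mathbb{R}\to\mathbb{R}$. A difference operator is a map $D:\mathbb{R}^{\mathbb{R}}\to\mathbb{R}^{\mathbb{R}}$ of the form $(Df)(x)=\sum_{i=1}^n a_i f(x+b_i)$ with $a_i,b_i\in\mathbb{R}$; $\mathcal{D}$ is the set of difference operators. A system of difference equations is a set $S\subset\mathcal{D}\times\mathbb{R}^{\mathbb{R}}$; a function $f:\mathbb{R}\to\mathbb{R}$ is a solution to $S$ if $Df=g$ for every $(D,g)\in S$. A subsystem of $S$ is a subset of $S$. For $\mathcal{F}\subset\mathbb{R}^{\mathbb{R}}$ the solvability cardinal $\mathrm{sc}(\mathcal{F})$ is the minimal cardinal $\kappa$ with the following property: for every system $S$ of difference equations, if every subsystem of $S$ of cardinality less than $\kappa$ has a solution in $\mathcal{F}$, then $S$ has a solution in $\mathcal{F}$. *)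

(* Defs.v *)
From HB Require Import structures.
From mathcomp Require Import all_boot all_order all_algebra.
From mathcomp Require Import boolp classical_sets functions cardinality reals.
From mathcomp Require Import measure lebesgue_measure measurable_realfun.

Set Implicit Arguments.
Unset Strict Implicit.
Unset Printing Implicit Defensive.

Import Order.TTheory GRing.Theory Num.Theory.

Local Open Scope classical_set_scope.
Local Open Scope card_scope.
Local Open Scope ring_scope.

(* A cardinal is represented by any set of that cardinality, so that equality *)
(* of cardinals is equipotence, #=. An equation between cardinals becomes the *)
(* existence of one set satisfying the predicates defining both sides; the    *)
(* lemmas below show that each predicate determines its set up to #=.         *)

Definition card_lt T U (A : set T) (B : set U) : Prop :=
  (A #<= B) /\ ~ (B #<= A).

Definition is_successor_cardinal T U (A : set T) (B : set U) : Prop :=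
  card_lt A B /\
  forall (V : Type) (C : set V), card_lt A C -> (B #<= C).

Fixpoint is_aleph (n : nat) (T : Type) (K : set T) : Prop :=
  if n is m.+1 then
    exists (U : Type) (L : set U), is_aleph m L /\ is_successor_cardinal L K
  else K #= [set: nat].

Definition continuum : set (nat -> bool) := [set: nat -> bool].

Definition continuum_hypothesis : Prop := is_aleph 1 continuum.

Definition is_difference_operator (R : realType)
    (D : (R -> R) -> (R -> R)) : Prop :=
  exists (n : nat) (a b : 'I_n -> R),
    forall (f : R -> R) (x : R), D f x = \sum_(i < n) a i * f (x + b i).

Definition difference_system (R : realType)
    (S : set (((R -> R) -> (R -> R)) * (R -> R))) : Prop :=
  forall p, S p -> is_difference_operator p.1.

Definition is_solution (R : realType)
    (S : set (((R -> R) -> (R -> R)) * (R -> R))) (f : R -> R) : Prop :=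
  forall D g, S (D, g) -> D f = g.

Definition solvable_in (R : realType) (F : set (R -> R))
    (S : set (((R -> R) -> (R -> R)) * (R -> R))) : Prop :=
  exists2 f, F f & is_solution S f.

Definition solvability_property (R : realType) (F : set (R -> R))
    (T : Type) (K : set T) : Prop :=
  forall S : set (((R -> R) -> (R -> R)) * (R -> R)),
    difference_system S ->
    (forall S', S' `<=` S -> card_lt S' K -> solvable_in F S') ->
    solvable_in F S.

Definition is_solvability_cardinal (R : realType) (F : set (R -> R))
    (T : Type) (K : set T) : Prop :=
  solvability_property F K /\
  forall (U : Type) (L : set U), solvability_property F L -> (K #<= L).

Definition borel_functions (R : realType) : set (R -> R) :=
  [set f | measurable_fun [set: measurableTypeR R]
             (f : measurableTypeR R -> measurableTypeR R)].

Lemma eq_successor_cardinal T T' U U' (A : set T) (A' : set T')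
    (B : set U) (B' : set U') : (A #= A') ->
  is_successor_cardinal A B -> is_successor_cardinal A' B' -> (B #= B').
Proof.
move=> AA' [[AB nBA] minB] [[AB' nBA'] minB'].
apply: Cantor_Bernstein.
- by apply: minB; split; rewrite ?(card_le_eql AA') ?(card_le_eqr AA').
- by apply: minB'; split; rewrite -?(card_le_eql AA') -?(card_le_eqr AA').
Qed.

Lemma eq_aleph n T U (A : set T) (B : set U) :
  is_aleph n A -> is_aleph n B -> (A #= B).
Proof.
elim: n T U A B => [|n IHn] T U A B /=.
  by move=> An Bn; apply: card_eq_trans An _; rewrite card_eq_sym.
move=> [V [C [nC CA]]] [W [D [nD DB]]].
exact: eq_successor_cardinal (IHn _ _ _ _ nC nD) CA DB.
Qed.

Lemma eq_solvability_cardinal (R : realType) (F : set (R -> R)) T U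
    (A : set T) (B : set U) :
  is_solvability_cardinal F A -> is_solvability_cardinal F B -> (A #= B).
Proof.
by move=> [FA minA] [FB minB]; apply: Cantor_Bernstein; [apply: minA|apply: minB].
Qed.

(* Main.v *)
Require Import Defs.
From mathcomp Require Import all_boot all_order all_algebra.
From mathcomp Require Import boolp classical_sets functions cardinality reals.
From mathcomp Require Import wochoice set_interval ereal measure.
From mathcomp Require Import lebesgue_measure measurable_realfun.
From mathcomp Require Import lebesgue_integral.

(** Let c be the cardinality of the continuum and K = c^+.

    The solvability cardinal is at most K because there are only c difference
    operators ([difference_operators_continuum]).  If all subsystems of size
    at most c are solvable, then no operator occurs with two right-hand sides,
    for the two equations would already form an unsolvable subsystem.  So the
    whole system is in bijection with a set of operators, has size at most c,
    and is one of the subsystems known to be solvable.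

    For the lower bound it is enough, under CH, to find an unsolvable system
    all of whose countable subsystems are solvable.  Following Sierpinski, CH
    gives a function f on the reals which is countable-to-one and, for each b,
    satisfies f (x + b) = f x for all but countably many x
    ([ch_almost_invariant]): well-order the reals with countable initial
    segments and let f x be the least z such that x lies in the additive group
    spanned by the reals up to z.  The system asks for h with the same
    differences h (x + b) - h x as f, for all b.
    - A countable part of it involves only the translations of a countable
      group, and f is invariant under this group outside a countable invariant
      set; keeping f on that set and 0 elsewhere is a Borel solution
      ([countable_translation_subsystem]).
    - A solution of the whole system differs from f by a constant, and f is
      not Borel ([borel_almost_invariant_fiber]): otherwise the planar set of
      pairs (x, b) with f (x + b) = f x would have countable vertical sections
      and cocountable horizontal ones, against Fubini.

    That K exists, and that it lies below every cardinal above c, follows by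
    comparing well-orders ([exists_successor_cardinal]). *)

Set Implicit Arguments.
Unset Strict Implicit.
Unset Printing Implicit Defensive.

Import Order.TTheory GRing.Theory Num.Theory.

Local Open Scope classical_set_scope.
Local Open Scope card_scope.
Local Open Scope ring_scope.

(** * Well-orders and successor cardinals *)

(** The strict, well-founded form of a well-order is the one that supports
    definition by recursion with [Fix]. *)
Definition strict_well_order T (lt : T -> T -> Prop) : Prop :=
  [/\ well_founded lt,
      forall x y z, lt x y -> lt y z -> lt x z
    & forall x y, [\/ lt x y, x = y | lt y x]].

Definition segment T (lt : T -> T -> Prop) (x : T) : set T := [set y | lt y x].

Lemma wf_minimal T (lt : T -> T -> Prop) (A : set T) :
  well_founded lt -> A !=set0 ->
  exists2 x, A x & forall y, lt y x -> ~ A y.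
Proof.
move=> wf [x Ax]; apply: contrapT => nomin.
elim/(well_founded_ind wf): x Ax => x IH Ax.
by apply: nomin; exists x.
Qed.

Lemma exists_strict_well_order (T : eqType) :
  exists lt : T -> T -> Prop, strict_well_order lt.
Proof.
have [le wole] := well_ordering_principle T.
have chle : wo_chain le predT by move=> A _; exact: wole.
have tot x y : le x y || le y x by exact: (wo_chainW chle).
have anti x y : le x y -> le y x -> x = y.
  by move=> xy yx; apply: (wo_chain_antisymmetric chle) => //; apply/andP.
have least (A : {pred T}) a : a \in A ->
    exists2 z, z \in A & forall w, w \in A -> le z w.
  by move=> Aa; have [|z [[Az zA] _]] := wole A; [exists a|exists z].
(* The least element of {x, y, z} decides transitivity. *)
have trans x y z : le x y -> le y z -> le x z.
  move=> xy yz; have [|w ws wmin] := least (mem [:: x; y; z]) x.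
    by rewrite !inE eqxx.
  have [wx wy wz] : [/\ le w x, le w y & le w z].
    by split; apply: wmin; rewrite !inE eqxx ?orbT.
  move: ws; rewrite !inE => /or3P[]/eqP E; subst w => //.
    by rewrite (anti _ _ xy wx).
  by rewrite -(anti _ _ yz wy).
exists (fun x y => le x y /\ x <> y); split.
- move=> x; apply: contrapT => nAx.
  have [|z zA zmin] :=
    least (fun a => `[< ~ Acc (fun x y => le x y /\ x <> y) a >]) x.
    by rewrite unfold_in; apply/asboolP.
  move: zA; rewrite unfold_in => /asboolP; apply; constructor => y [yz ne].
  apply: contrapT => nAy; apply: ne; apply: anti => //; apply: zmin.
  by rewrite unfold_in; apply/asboolP.
- move=> x y z [xy nxy] [yz nyz]; split; first exact: trans yz.
  by move=> E; subst z; apply: nxy; exact: anti.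
- move=> x y; have [->|/eqP nxy] := eqVneq x y; first by constructor 2.
  have /orP[xy|yx] := tot x y; first by constructor 1.
  by constructor 3; split => // /esym.
Qed.

Lemma card_le_injective T U (A : set T) (B : set U) (f : T -> U) :
  (forall x, A x -> B (f x)) ->
  (forall x y, A x -> A y -> f x = f y -> x = y) -> A #<= B.
Proof.
move=> fAB finj; suff [g] : $|{injfun A >-> B}| by exact: inj_card_le g.
apply/injfunPex; exists f => // x y; rewrite !inE; exact: finj.
Qed.

(** Choose the image of each x in K, by recursion, in C and outside the images
    of the smaller elements of K.  Either this never gets stuck, and K embeds
    into C, or it gets stuck at some x, and then the elements below x already
    cover C. *)
Lemma well_order_embedding T (lt : T -> T -> Prop) U (K : set T) (C : set U) :
  strict_well_order lt ->
  (K #<= C) \/ exists2 x, K x & (C #<= K `&` segment lt x).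
Proof.
move=> [wf _ tri].
have [[x Kx Cx]|nseg] := pselect (exists2 x, K x & (C #<= K `&` segment lt x)).
  by right; exists x.
left; have [[x Kx]|K0] := pselect (K !=set0); last first.
  rewrite (_ : K = set0) ?card_ge0//.
  by apply/seteqP; split=> // x Kx; apply: K0; exists x.
elim/Ppointed: U => U in C nseg *.
  by case: nseg; exists x => //; rewrite emptyE.
pose next x (g : forall y, lt y x -> U) : U :=
  get [set u | C u /\ forall y (yx : lt y x), K y -> g y yx <> u].
pose h := Fix wf (fun=> U) next.
have hE x' : h x' = get [set u | C u /\ forall y, lt y x' -> K y -> h y <> u].
  rewrite /h Fix_eq // => z f g fg.
  by congr next; apply/functional_extensionality_dep => y; apply/funext.
have hP y : K y -> C (h y) /\ forall z, lt z y -> K z -> h z <> h y.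
  move=> Ky.
  pose fresh := [set u | C u /\ forall z, lt z y -> K z -> h z <> u].
  suff : fresh (h y) by [].
  rewrite hE; apply: getPex.
  apply: contrapT => none; apply: nseg; exists y => //.
  have sub : C `<=` h @` (K `&` segment lt y).
    move=> u Cu; apply: contrapT => nu; apply: none.
    exists u; split=> // z zy Kz hzu.
    by apply: nu; exists z.
  exact: card_le_trans (subset_card_le sub) (card_image_le _ _).
apply: (card_le_injective (f := h)) => [y /hP[]//|y z Ky Kz hyz].
have [yz|//|zy] := tri y z.
- by have [_ /(_ y yz Ky)] := hP z Kz.
- by have [_ /(_ z zy Kz)] := hP y Ky; rewrite hyz.
Qed.

Lemma card_le_total T U (A : set T) (B : set U) : (A #<= B) \/ (B #<= A).
Proof.
elim/Pchoice: T => T in A *.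
have [lt wo] := exists_strict_well_order T.
have [|[x _ Bx]] := well_order_embedding A B wo; first by left.
by right; apply: card_le_trans Bx _; apply: subset_card_le; exact: subIsetl.
Qed.

Lemma card_ltNge T U (A : set T) (B : set U) : card_lt A B <-> ~ (B #<= A).
Proof. by split=> [[]//|nBA]; split=> //; have [] := card_le_total A B. Qed.

(** Take for K the initial segment of those x with at most |A| predecessors.
    Were |K| at most |A|, the least element outside K would have all its
    predecessors in K, hence at most |A| of them. *)
Lemma exists_hartogs T U (A : set T) (lt : U -> U -> Prop) :
  well_founded lt -> ~ ([set: U] #<= A) ->
  exists2 K : set U, ~ (K #<= A) & forall x, K x -> (K `&` segment lt x #<= A).
Proof.
move=> wf nUA; pose K := [set x | segment lt x #<= A].
exists K => [KA|x Kx]; last first.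
  exact: card_le_trans (subset_card_le (@subIsetr _ _ _)) Kx.
have [[x nKx]|nn] := pselect (~` K !=set0).
  have [y nKy miny] := wf_minimal wf (ex_intro _ x nKx : ~` K !=set0).
  case: nKy; apply: card_le_trans KA; apply: subset_card_le => z zy.
  by apply: contrapT => nKz; exact: miny zy nKz.
apply: nUA; apply: card_le_trans KA; apply: subset_card_le => x _.
by apply: contrapT => nKx; apply: nn; exists x.
Qed.

Lemma card_powerset_nle T : ~ ([set: set T] #<= [set: T]).
Proof.
move=> /pcard_surjP[g /(_ [set x | ~ g x x] I)[x _ gx]].
have : g x x = ~ g x x by rewrite [in LHS]gx.
move=> E; have n : ~ g x x by move=> h; move: (h); rewrite E; apply.
by apply: (n); rewrite E.
Qed.

(** The successor is realized by a subset of the power set, which by Cantor's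
    theorem is large enough for the Hartogs construction. *)
Lemma exists_successor_cardinal T (A : set T) :
  exists K : set (set T), is_successor_cardinal A K.
Proof.
have [lt wo] := exists_strict_well_order (set T).
have nTA : ~ ([set: set T] #<= A).
  by move=> TA; apply: (@card_powerset_nle T);
    exact: card_le_trans TA (card_leT _).
have [K nKA segK] := exists_hartogs (let: And3 wf _ _ := wo in wf) nTA.
exists K; split; first exact/card_ltNge.
move=> V C /card_ltNge nCA; have [//|[x Kx Cx]] := well_order_embedding K C wo.
by case: nCA; apply: card_le_trans Cx (segK x Kx).
Qed.

Lemma ch_uncountable V (C : set V) :
  continuum_hypothesis -> ~ countable C -> continuum #<= C.
Proof.
move=> [U [L [/= Lnat [_ minc]]]] nC; apply: minc.
by apply/card_ltNge => CL; apply: nC; rewrite /countable -(card_le_eqr Lnat).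
Qed.

(** * There are continuum many difference operators *)

Lemma predicates_continuum (X : countType) : [set: X -> bool] #<= continuum.
Proof.
apply: (card_le_injective
  (f := fun (phi : X -> bool) n =>
     if unpickle n is Some x then phi x else false)) => //.
move=> phi psi _ _ E; apply/funext => x.
by have := congr1 (fun g => g (pickle x)) E; rewrite /= pickleK.
Qed.

Lemma countable_le_continuum T (A : set T) : countable A -> A #<= continuum.
Proof.
move=> cA; apply: card_le_trans cA _.
apply: (card_le_injective (f := fun n m => m == n)) => // m n _ _ E.
by have := congr1 (fun g => g m) E; rewrite /= eqxx => /esym/eqP.
Qed.

Lemma real_cut_inj (R : realType) (x y : R) :
  (forall q : rat, (ratr q < x) = (ratr q < y)) -> x = y.
Proof.
wlog xy : x y / x < y.
  move=> W E; have [xy|yx|//] := ltgtP x y; first exact: W.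
  by apply/esym/W.
move=> E; have [q] := rat_in_itvoo xy; rewrite in_itv/= => /andP[xq qy].
by have := E q; rewrite qy ltNge (ltW xq).
Qed.

(** A sequence of pairs is encoded by countably many yes-no questions: its
    length, and the position of every rational with respect to each component
    of each entry (Dedekind cuts). *)
Lemma real_seq_continuum (R : realType) : [set: seq (R * R)] #<= continuum.
Proof.
apply: card_le_trans
  (predicates_continuum (option (nat * rat * bool) * nat)%type).
apply: (card_le_injective (f := fun s : seq (R * R) =>
  fun p : option (nat * rat * bool) * nat =>
  if p.1 is Some (i, q, b) then
    ratr q < (if b then (nth 0 s i).1 else (nth 0 s i).2)
  else p.2 == size s)) => // s t _ _ E.
have sz : size s = size t.
  by have := congr1 (fun g => g (None, size s)) E; rewrite /= eqxx => /esym/eqP.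
apply: (eq_from_nth (x0 := 0)) => // i _.
have H b : (if b then (nth 0 s i).1 else (nth 0 s i).2) =
           (if b then (nth 0 t i).1 else (nth 0 t i).2).
  apply: real_cut_inj => q.
  exact: (congr1 (fun g => g (Some (i, q, b), 0%N)) E).
by rewrite [nth 0 s i]surjective_pairing (H true) (H false) -surjective_pairing.
Qed.

Lemma difference_operators_continuum (R : realType) :
  [set D | @is_difference_operator R D] #<= continuum.
Proof.
apply: card_le_trans (real_seq_continuum R).
pose op (s : seq (R * R)) (f : R -> R) (x : R) :=
  \sum_(p <- s) p.1 * f (x + p.2).
apply: card_le_trans (card_image_le op setT).
apply: subset_card_le => D [n [a [b DE]]].
exists [seq (a i, b i) | i <- enum 'I_n] => //.
apply/funext => f; apply/funext => x.
by rewrite /op big_map big_enum DE.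
Qed.

(** A system whose small subsystems are solvable contains each operator at most
    once, hence is no larger than the set of operators: it is one of its own
    small subsystems. *)
Lemma solvability_property_above_continuum (R : realType)
    (F : set (R -> R)) T (K : set T) :
  card_lt continuum K -> solvability_property F K.
Proof.
move=> /card_ltNge cK S dS subS.
have ltK V (C : set V) : C #<= continuum -> card_lt C K.
  by move=> Cc; apply/card_ltNge => KC; apply: cK; exact: card_le_trans KC Cc.
apply: (subS) => //; apply: (ltK).
apply: card_le_trans (difference_operators_continuum R).
apply: (card_le_injective (f := fst)) => [p Sp|[D g] [D' g'] Sg Sg' /= DD'].
  exact: dS.
subst D'; congr (_, _).
(* Two equations with the same operator have a common solution. *)
have [||f _ sf] := subS [set (D, g); (D, g')].
- by move=> p [->|->].
- apply: ltK; apply: countable_le_continuum; apply: finite_set_countable.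
  exact: finite_set2.
have Dg : D f = g by apply: sf; left.
have Dg' : D f = g' by apply: sf; right.
by rewrite -Dg -Dg'.
Qed.

(** * Subgroups spanned by countable sets *)

Lemma countable_seq (T : eqType) (C : set T) :
  countable C -> countable [set s : seq T | forall x, x \in s -> C x].
Proof.
move=> /countable_injP[g ginj].
apply: (@sub_countable _ _ _ [set: seq nat]); last exact: countableP.
apply: (card_le_injective (f := map g)) => //.
elim=> [|x s IH] [|y t] //= Cs Ct [gxy gst]; congr (_ :: _).
  by apply: ginj => //; rewrite inE; [apply: Cs|apply: Ct]; rewrite inE eqxx.
by apply: IH => // z zs; [apply: Cs|apply: Ct]; rewrite inE zs orbT.
Qed.

(** Elements of the span are written as sums of signed elements of C, the
    boolean marking a minus sign, so that a countable C visibly has a countable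
    span. *)
Definition subgroup_span (V : zmodType) (C : set V) : set V :=
  [set \sum_(p <- s) (if p.2 then - p.1 else p.1)
     | s in [set s : seq (V * bool) | forall p, p \in s -> C p.1]].

Section Span.
Variable V : zmodType.
Implicit Types (C : set V) (x y : V).

Lemma countable_subgroup_span C : countable C -> countable (subgroup_span C).
Proof.
move=> cC; apply: (sub_countable (card_image_le _ _)).
apply: (@sub_countable _ _ _
  [set s : seq (V * bool) | forall p, p \in s -> (C `*` setT) p]).
  by apply: subset_card_le => s Cs p /Cs.
by apply: countable_seq; apply: countableX => //; exact: countableP.
Qed.

Lemma subset_subgroup_span C : C `<=` subgroup_span C.
Proof.
by move=> x Cx; exists [:: (x, false)]; rewrite ?big_seq1// => p;
  rewrite inE => /eqP->.
Qed.

Lemma subgroup_spanS C C' : C `<=` C' -> subgroup_span C `<=` subgroup_span C'.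
Proof. by move=> CC' x [s Cs <-]; exists s => // p /Cs/CC'. Qed.

Lemma subgroup_spanD C x y :
  subgroup_span C x -> subgroup_span C y -> subgroup_span C (x + y).
Proof.
move=> [s Cs <-] [t Ct <-]; exists (s ++ t); last by rewrite big_cat.
by move=> p; rewrite mem_cat => /orP[/Cs|/Ct].
Qed.

Lemma subgroup_spanN C x : subgroup_span C x -> subgroup_span C (- x).
Proof.
move=> [s Cs <-]; exists [seq (p.1, ~~ p.2) | p <- s].
  by move=> _ /mapP[p /Cs Cp ->].
by rewrite big_map -sumrN; apply: eq_bigr => -[z []] _ //=; rewrite opprK.
Qed.

Lemma subgroup_spanDr C x y :
  subgroup_span C y -> (subgroup_span C (x + y) <-> subgroup_span C x).
Proof.
move=> Cy; split=> [Cxy|Cx]; last exact: subgroup_spanD.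
by rewrite -[x](addrK y); apply: subgroup_spanD => //; exact: subgroup_spanN.
Qed.

End Span.

(** * Sierpinski's almost invariant function *)

(** The Hartogs construction gives an uncountable well-order whose initial
    segments are countable; CH makes it large enough to embed the reals. *)
Lemma ch_short_well_order (R : realType) : continuum_hypothesis ->
  exists2 lt : R -> R -> Prop,
    strict_well_order lt & forall x, countable (segment lt x).
Proof.
move=> CH; have [lt wo] := exists_strict_well_order (nat -> bool).
have [wf trans tri] := wo.
have nc : ~ countable [set: nat -> bool].
  move: CH => [U [L [Lnat [[_ ncL] _]]]] c; apply: ncL.
  by rewrite /continuum (card_le_eqr Lnat).
have [K nK segK] := exists_hartogs wf nc.
have RK : [set: R] #<= K.
  apply: card_le_trans (ch_uncountable CH nK).
  apply: card_le_trans (real_seq_continuum R).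
  by apply: (card_le_injective (f := fun x => [:: (x, x)])) => // x y _ _ [].
have /pcard_leP/unsquash e := RK.
have eK x : K (e x) by exact: funS.
have einj x y : e x = e y -> x = y by apply: (inj (f := e)); rewrite inE.
exists (fun x y => lt (e x) (e y)) => [|x].
  split => [|x y z|x y].
  - move=> x; move: {2}(e x) (erefl (e x)) => u.
    elim/(well_founded_ind wf): u x.
    by move=> u IH x ex; constructor=> y yx; apply: IH (erefl _); rewrite -ex.
  - exact: trans.
  - have [exy|/einj->|eyx] := tri (e x) (e y).
    + by constructor 1.
    + by constructor 2.
    + by constructor 3.
apply: card_le_trans (segK (e x) (eK x)).
by apply: (card_le_injective (f := e)) => // y z _ _ /einj.
Qed.

(** Let G z be the group spanned by the reals up to z.  These groups are
    countable and increase with z, and f x is the least z with x in G z.  The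
    fiber of f over z lies in G z, and for x outside G b the numbers x and
    x + b belong to exactly the same groups G z: to none with z up to b, and
    together for larger z, since b is in G z. *)
Lemma ch_almost_invariant (R : realType) : continuum_hypothesis ->
  exists f : R -> R, (forall z, countable [set x | f x = z]) /\
    forall b, countable [set x | f (x + b) <> f x].
Proof.
move=> CH; have [lt [wf trans tri] cseg] := ch_short_well_order R CH.
pose G z := subgroup_span [set y | y = z \/ lt y z].
have cG z : countable (G z).
  apply: countable_subgroup_span; rewrite (_ : [set _ | _] =
    \bigcup_(b in [set: bool]) if b then [set z] else segment lt z).
    by apply: bigcup_countable => [|[] _];
      [exact: countableP|exact: countable1|].
  apply/seteqP; split => [y [->|yz]|y [[] _]];
    by [exists true|exists false|left|right].
have GG z w : lt z w -> G z `<=` G w.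
  by move=> zw; apply: subgroup_spanS => y [->|yz]; right=> //; exact: trans zw.
have Gid z : G z z by apply: subset_subgroup_span; left.
have /choice[f fP] x : exists z, G z x /\ forall w, lt w z -> ~ G w x.
  have [|z Gz minz] := wf_minimal (A := [set z | G z x]) wf; last by exists z.
  by exists x; exact: Gid.
exists f; split=> [z|b].
  apply: sub_countable (cG z); apply: subset_card_le => x /= <-.
  by have [] := fP x.
apply: sub_countable (cG b); apply: subset_card_le => x /= ne.
apply: contrapT => nGbx; apply: ne.
have Gb z : (G z (x + b) <-> G z x).
  have [bz|->|zb] := tri b z.
  - by apply: subgroup_spanDr; exact: GG bz _ (Gid b).
  - by apply: subgroup_spanDr; exact: Gid.
  - split=> [/(GG _ _ zb)|/(GG _ _ zb)//].
    by move=> /(subgroup_spanDr _ (Gid b)).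
have [Gx minx] := fP x; have [Gxb minxb] := fP (x + b).
have [l|//|l] := tri (f (x + b)) (f x).
- by case: (minx _ l); exact/Gb.
- by case: (minxb _ l); exact/Gb.
Qed.

(** * Borel functions that are almost invariant under all translations *)

(** Suppose that all fibers of f are countable, and let E be the set of pairs
    (x, b) with f (x + b) = f x.  Its section at x is a translate of a fiber,
    and the section of its complement at b is the exceptional set of b.  All
    these are Lebesgue null, so integrating E along one axis and its complement
    along the other shows that the whole plane is null. *)
Lemma borel_almost_invariant_fiber (R : realType) (f : R -> R) :
  borel_functions f ->
  (forall b, countable [set x | f (x + b) <> f x]) ->
  exists z, ~ countable [set x | f x = z].
Proof.
move=> mf ainv; apply/existsNP => cfib.
pose TR := measurableTypeR R.
pose mu : {sigma_finite_measure set TR -> \bar R} := @lebesgue_measure R.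
pose E : set (TR * TR) := [set p | f (p.1 + p.2) = f p.1].
have mE : measurable E.
  have mg : measurable_fun setT (fun p : TR * TR =>
      f (p.1 + p.2) == f p.1).
    apply: measurable_fun_eqr.
    - apply: (measurableT_comp (f := f : TR -> TR)) => //.
      apply: measurable_funD; [exact: measurable_fst|exact: measurable_snd].
    - apply: (measurableT_comp (f := f : TR -> TR)) => //.
  rewrite (_ : E = setT `&` (fun p => f (p.1 + p.2) == f p.1) @^-1` [set true]).
    exact: mg.
  by rewrite setTI; apply/seteqP; split=> p /eqP.
pose P : {measure set (TR * TR) -> \bar R} := (mu \x mu)%E.
have E1 : P E = 0%E.
  rewrite /P/= /product_measure1 integral0_eq // => x _ /=.
  apply: countable_lebesgue_measure0.
  have cx : countable [set y | f y = f x] := cfib (f x).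
  rewrite (_ : xsection _ _ = (fun b => x + b) @^-1` [set y | f y = f x]).
    apply: sub_countable cx.
    by apply: (card_le_injective (f := fun b => x + b)) => // y z _ _ /addrI.
  by apply/seteqP; split=> y; rewrite /xsection/= inE.
have E2 : P (~` E) = 0%E.
  transitivity ((mu \x^ mu)%E (~` E)).
    apply: (product_measure_unique (m' := (mu \x^ mu)%E));
      last exact: measurableC.
    by move=> A B mA mB; exact: product_measure2E.
  rewrite /product_measure2 integral0_eq // => b _ /=.
  apply: countable_lebesgue_measure0.
  rewrite (_ : ysection _ _ = [set x | f (x + b) <> f x]) //.
  by apply/seteqP; split=> x; rewrite /ysection/= inE.
have PT0 : P setT = 0%E.
  transitivity (P E + P (~` E))%E; last by rewrite E1 E2 adde0.
  rewrite -[in LHS](setUv E).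
  by apply: measureU => //; [exact: measurableC|exact: setICr].
have : P setT = +oo%E.
  have muT : mu setT = +oo%E by rewrite /mu /= -set_itvNyy lebesgue_measure_itv.
  transitivity (mu setT * mu setT)%E; last by rewrite muT mulyy.
  by rewrite -setXTT; exact: product_measure1E.
by rewrite PT0.
Qed.

Lemma borel_countable_support (R : realType) (f : R -> R) :
  countable [set x | f x <> 0] -> borel_functions f.
Proof.
move=> cf _ Y mY; rewrite setTI.
have mset (A : set R) : countable A -> measurable (A : set (measurableTypeR R)).
  by apply: countable_measurable => x; exact: measurable_set1.
have [Y0|nY0] := pselect (Y 0).
  rewrite -[_ @^-1` _]setCK; apply: measurableC; apply: mset.
  apply: sub_countable cf; apply: subset_card_le => x /= nY fx0.
  by apply: nY; rewrite fx0.
apply: mset; apply: sub_countable cf; apply: subset_card_le => x /= Yx fx0.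
by apply: nY0; rewrite -fx0.
Qed.

(** * The translation system of an almost invariant function *)

Definition difference_by (R : realType) (b : R) (f : R -> R) : R -> R :=
  fun x => f (x + b) - f x.

Lemma difference_by_operator (R : realType) (b : R) :
  is_difference_operator (difference_by b).
Proof.
exists 2%N, (fun i => if i == ord0 then 1 else -1),
  (fun i => if i == ord0 then b else 0).
by move=> f x; rewrite !big_ord_recl big_ord0 /= mul1r mulN1r !addr0.
Qed.

Definition translation_system (R : realType) (f : R -> R) :
    set (((R -> R) -> (R -> R)) * (R -> R)) :=
  [set (difference_by b, difference_by b f) | b in setT].

(** The shifts b occurring in S span a countable group H.  The set C of points
    where f fails to be H-invariant is countable and H-invariant; so the
    function equal to f on C and to 0 elsewhere has the same differences as f
    along H, and it is Borel since its support is countable. *)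
Lemma countable_translation_subsystem (R : realType) (f : R -> R) S :
  (forall b, countable [set x | f (x + b) <> f x]) ->
  S `<=` translation_system f -> countable S ->
  solvable_in (@borel_functions R) S.
Proof.
move=> ainv Sf cS.
(* Distinct shifts give distinct operators, so there are countably many. *)
pose B := [set b | S (difference_by b, difference_by b f)].
have cB : countable B.
  apply: sub_countable cS.
  apply: (card_le_injective
    (f := fun b => (difference_by b, difference_by b f))) => //.
  move=> b c _ _ [/(congr1 (fun D => D id 0)) + _].
  by rewrite /difference_by !add0r !subr0.
pose H := subgroup_span B.
pose C := \bigcup_(b in H) [set x | f (x + b) <> f x].
have cC : countable C.
  by apply: bigcup_countable => //; exact: countable_subgroup_span.
have invC b x : H b -> ~ C x -> f (x + b) = f x.
  by move=> Hb nCx; apply: contrapT => ne; apply: nCx; exists b.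
have CC b x : H b -> C (x + b) -> C x.
  move=> Hb [c Hc /= ne]; apply: contrapT => nCx; apply: ne.
  by rewrite -addrA !invC//; exact: subgroup_spanD.
pose h x := if `[< C x >] then f x else 0.
exists h.
  apply: borel_countable_support; apply: sub_countable cC.
  apply: subset_card_le => x.
  by rewrite /= /h; case: asboolP.
move=> D g /[dup] Sg /Sf[b _ [DE gE]]; move: Sg; rewrite -DE -gE => Bb.
have Hb : H b by exact: subset_subgroup_span.
apply/funext => x; rewrite /difference_by /h.
case: asboolP => [Cxb|nCxb]; first by rewrite asboolT//; exact: CC Cxb.
have nCx : ~ C x.
  move=> Cx; apply: nCxb; apply: (CC (- b)); rewrite ?addrK//.
  exact: subgroup_spanN.
by rewrite asboolF// invC// !subrr.
Qed.

(** Two solutions differ by a constant, because all shifts occur in the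
    system; hence a Borel solution would make f Borel. *)
Lemma translation_system_unsolvable (R : realType) (f : R -> R) :
  (forall z, countable [set x | f x = z]) ->
  (forall b, countable [set x | f (x + b) <> f x]) ->
  ~ solvable_in (@borel_functions R) (translation_system f).
Proof.
move=> cfib ainv [h bh sh].
have hE b : h b - h 0 = f b - f 0.
  have E : difference_by b h = difference_by b f by apply: sh; exists b.
  by have := congr1 (fun g => g 0) E; rewrite /difference_by add0r.
have [|z] := @borel_almost_invariant_fiber R f _ ainv;
  last by apply; exact: cfib.
rewrite (_ : f = fun x => h x - (h 0 - f 0)); first exact: measurable_funB.
by apply/funext => x; rewrite opprB addrA addrAC hE subrK.
Qed.

(** Under CH a set that is smaller than some set of size at most continuum is
    countable, so the translation system refutes the property for every L of
    size at most continuum. *)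
Lemma ch_borel_solvability_above_continuum (R : realType) U (L : set U) :
  continuum_hypothesis -> solvability_property (@borel_functions R) L ->
  card_lt continuum L.
Proof.
move=> CH sL; apply/card_ltNge => Lc.
have [f [cfib ainv]] := ch_almost_invariant R CH.
apply: (translation_system_unsolvable cfib ainv); apply: sL.
  by move=> _ [b _ <-]; exact: difference_by_operator.
move=> S' S'f [_ nLS']; apply: countable_translation_subsystem S'f _ => //.
apply: contrapT => nc; apply: nLS'.
exact: card_le_trans Lc (ch_uncountable CH nc).
Qed.

Theorem corollary6p3 (R : realType) : continuum_hypothesis ->
  exists (T : Type) (K : set T),
    [/\ is_solvability_cardinal (@borel_functions R) K,
        is_aleph 2 K
      & is_successor_cardinal continuum K].
Proof.
move=> CH; have [K [cK minK]] := exists_successor_cardinal continuum.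
exists _, K; split=> //; last by exists _, continuum.
split=> [|U L sL]; first exact: solvability_property_above_continuum.
exact/minK/(ch_borel_solvability_above_continuum CH sL).
Qed.
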